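(* Let $M$ be a contact $CR$-submanifold of a Sasakian statistical manifold $(\bar M,\bar\nabla,\bar g,\phi,\xi)$, with distributions $D$ and $D^\perp$. If $M$ is $D$-umbilic with respect to $\bar\nabla$ (respectively $\bar\nabla^*$), then $M$ is $D$-totally geodesic with respect to $\bar\nabla$ (respectively $\bar\nabla^*$).
   Context: A statistical manifold $(\bar M,\bar\nabla,\bar g)$ is a smooth Riemannian manifold $(\bar M,\bar g)$ with a torsion-free affine connection $\bar\nabla$ such that $(\bar\nabla_X\bar g)(Y,Z)=(\bar\nabla_Y\bar g)(X,Z)$. The dual connection $\bar\nabla^*$ is defined by $X\bar g(Y,Z)=\bar g(\bar\nabla_XY,Z)+\bar g(Y,\bar\nabla^*_XZ)$. Let $\hat{\bar\nabla}$ be the Levi-Civita connection of $\bar g$ and $K(X,Y)=\bar\nabla_XY-\hat{\bar\nabla}_XY$. An almost contact metric structure on an odd-dimensional $(\bar M,\bar g)$ consists of a $(1,1)$-tensor $\phi$, a unit vector field $\xi$ and a 1-form $\eta$ with $\phi^2X=-X+\eta(X)\xi$, $\bar g(X,\xi)=\eta(X)$, $\bar g(\phi X,\phi Y)=\bar g(X,Y)-\eta(X)\eta(Y)$ (so $\phi\xi=0$, $\eta\circ\phi=0$, $\bar g(\phi X,Y)=-\bar g(X,\phi Y)$). A Sasakian statistical manifold $(\bar M,\bar\nabla,\bar g,\phi,\xi)$ is a statistical manifold with an almost contact metric structure such that $\hat{\bar\nabla}_X\xi=\phi X$, $(\hat{\bar\nabla}_X\phi)Y=\bar g(Y,\xi)X-\bar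 g(Y,X)\xi$ and $K(X,\phi Y)+\phi K(X,Y)=0$. Consequently $\bar\nabla_X\phi Y-\phi\bar\nabla^*_XY=\bar g(Y,\xi)X-\bar g(Y,X)\xi$ and $\bar\nabla_X\xi=\phi X+\bar g(\bar\nabla_X\xi,\xi)\xi$, and the same identities hold with $\bar\nabla$ and $\bar\nabla^*$ interchanged. For a submanifold $M$ with induced metric $g$ and $X,Y\in\Gamma(TM)$, split into tangential and normal parts: $\bar\nabla_XY=\nabla_XY+h(X,Y)$, $\bar\nabla^*_XY=\nabla^*_XY+h^*(X,Y)$. $M$ is a contact $CR$-submanifold if $TM=D\oplus D^\perp$ for a differentiable distribution $D$ with $\xi\in\Gamma(D)$, $\phi(D_x)\subseteq D_x$, and with orthogonal complement $D^\perp$ satisfying $\phi(D^\perp_x)\subseteq T^\perp_xM$ for all $x\in M$. It is $D$-umbilic with respect to $\bar\nabla$ (respectively $\bar\nabla^*$) if there is a normal vector field $L$ with $h(X,Y)=g(X,Y)L$ (respectively $h^*(X,Y)=g(X,Y)L$) for all $X,Y\in\Gamma(D)$. It is $D$-totally geodesic with respect to $\bar\nabla$ (respectively $\bar\nabla^*$) if $h(X,Y)=0$ (respectively $h^*(X,Y)=0$) for all $X,Y\in\Gamma(D)$. *)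

(* Defs.v *)
From HB Require Import structures.
From mathcomp Require Import all_boot all_order all_algebra.
From mathcomp Require Import all_classical all_reals all_analysis.
From mathcomp Require Import ring.

Set Implicit Arguments.
Unset Strict Implicit.
Unset Printing Implicit Defensive.

Import Order.TTheory GRing.Theory Num.Theory.
Import numFieldNormedType.Exports.

Local Open Scope classical_set_scope.
Local Open Scope ring_scope.

(* C^k and C^oo functions on a set U, meant for U open; differentiability is
   Fréchet differentiability, and the derivatives of order k+1 are the
   directional derivatives of those of order k. *)
Fixpoint Ck_on (R : realType) (V W : normedModType R) (k : nat) (U : set V)
    (f : V -> W) : Prop :=
  if k is k'.+1 then
    (forall x, U x -> differentiable f x) /\
    (forall v, Ck_on k' U ('D_v f))
  else forall x, U x -> {for x, continuous f}.

Definition smooth_on (R : realType) (V W : normedModType R) (U : set V)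
    (f : V -> W) : Prop := forall k, Ck_on k U f.

Section SmoothCalculus.
Variable R : realType.

Lemma near_eq_differentiable (V W : normedModType R) (f g : V -> W) (x : V) :
  (\near x, f x = g x) -> differentiable f x -> differentiable g x.
Proof.
move=> fg df; have [dc E] := (diff_locallyP x f).1 df.
have Eg : g \o shift x = cst (g x) + 'd f x +o_ 0 id.
  apply/eqaddoP => e e0.
  have /eqaddoP/(_ e e0) := E.
  have fg0 : \forall h \near 0, f (h + x) = g (h + x).
    by move: fg; rewrite (near_shift 0) /= subr0.
  apply: filterS2 fg0 => h; rewrite !fctE /= => ->.
  by rewrite (nbhs_singleton fg).
have Ed := diff_unique dc Eg.
apply/diff_locallyP; split; first by rewrite Ed.
by rewrite Ed.
Qed.

Lemma Ck_ext (V W : normedModType R) k (U : set V) (f g : V -> W) : open U ->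
  (forall x, U x -> f x = g x) -> Ck_on k U f -> Ck_on k U g.
Proof.
move=> oU; elim: k f g => [|k IH] f g fg /=.
  move=> cf x Ux; have nfg : \forall y \near x, f y = g y.
    by near=> y; apply: fg; near: y; exact: open_nbhs_nbhs.
  have := cf x Ux; rewrite /prop_for /continuous_at (fg x Ux).
  by apply: cvg_trans; apply: near_eq_cvg; apply: filterS nfg => y ->.
have nfg x : U x -> \forall y \near x, f y = g y.
  by move=> Ux; near=> y; apply: fg; near: y; exact: open_nbhs_nbhs.
move=> [df Df]; split=> [x Ux|v].
  exact: near_eq_differentiable (nfg _ Ux) (df _ Ux).
apply: (IH _ _ _ (Df v)) => x Ux; exact: near_eq_derive (nfg _ Ux).
Unshelve. all: by end_near. Qed.

Lemma CkS (V W : normedModType R) k (U : set V) (f : V -> W) :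
  Ck_on k.+1 U f -> Ck_on k U f.
Proof.
elim: k f => [|k IH] f [df Df]; last by split=> // v; exact: IH.
by move=> x /df /differentiable_continuous.
Qed.

Lemma Ck_local (V W : normedModType R) k (U : set V) (f : V -> W) :
  (forall x, U x -> exists2 O, O x & Ck_on k O f) -> Ck_on k U f.
Proof.
elim: k f => [|k IH] f loc /=.
  by move=> x /loc [ O Ox cf]; exact: cf.
split=> [x /loc [ O Ox [df _]]|v]; first exact: df.
by apply: IH => x /loc [ O Ox [_ /(_ v) Df]]; exists O.
Qed.

Lemma Ck_sub (V W : normedModType R) k (U O : set V) (f : V -> W) :
  U `<=` O -> Ck_on k O f -> Ck_on k U f.
Proof. by move=> UO fO; apply: Ck_local => x /UO; exists O. Qed.

Lemma Ck_cst (V W : normedModType R) k (U : set V) (a : W) :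
  Ck_on k U (cst a : V -> W).
Proof.
elim: k a => [|k IH] a /=; first by move=> x _; exact: cvg_cst.
split=> [x _|v]; first exact: differentiable_cst.
rewrite (_ : 'D_v (cst a) = cst 0); first exact: IH.
by apply/funext => x; rewrite derive_cst.
Qed.

Lemma CkD (V W : normedModType R) k (U : set V) (f g : V -> W) : open U ->
  Ck_on k U f -> Ck_on k U g -> Ck_on k U (f + g).
Proof.
move=> oU; elim: k f g => [|k IH] f g /=.
  by move=> cf cg x Ux; apply: cvgD; [exact: cf|exact: cg].
move=> [df Df] [dg Dg]; split=> [x Ux|v].
  by apply: differentiableD; [exact: df|exact: dg].
apply: (@Ck_ext _ _ _ _ ('D_v f + 'D_v g)) => //; last exact: IH.
by move=> x Ux; rewrite deriveD//; apply: diff_derivable; [exact: df|exact: dg].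
Qed.

Lemma CkM (V : normedModType R) k (U : set V) (f g : V -> R) : open U ->
  Ck_on k U f -> Ck_on k U g -> Ck_on k U (f * g).
Proof.
move=> oU; elim: k f g => [|k IH] f g.
  by move=> cf cg x Ux; apply: cvgM; [exact: cf|exact: cg].
move=> Cf Cg; have [[df Df] [dg Dg]] := (Cf, Cg); split=> [x Ux|v].
  by apply: differentiableM; [exact: df|exact: dg].
apply: (@Ck_ext _ _ _ _ (f * 'D_v g + g * 'D_v f)) => //.
  move=> x Ux; rewrite deriveM//; apply: diff_derivable; [exact: df|exact: dg].
by apply: CkD => //; apply: IH;
  [exact: CkS Cf|exact: Dg|exact: CkS Cg|exact: Df].
Qed.

Lemma Ck_sum (V W : normedModType R) k (U : set V) n (F : 'I_n -> V -> W) :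
  open U -> (forall i, Ck_on k U (F i)) -> Ck_on k U (\sum_i F i).
Proof.
by move=> oU CF; elim/big_ind: _ => [|f g|i _//]; [exact: Ck_cst|exact: CkD].
Qed.

Lemma Ck_coord (V : normedModType R) k (U : set V) n (F : V -> 'rV[R]_n) i :
  open U -> Ck_on k U F -> Ck_on k U (fun x => F x 0 i).
Proof.
move=> oU; elim: k F => [|k IH] F /=.
  move=> cF x /cF cFx.
  exact: (@continuous_comp _ _ _ F (fun M : 'rV[R]_n => M 0 i)) cFx
    (differentiable_continuous (differentiable_coord _ _ _)).
move=> [dF DF]; split=> [x /dF dFx|v].
  exact: (@differentiable_comp _ _ _ _ F (fun M : 'rV[R]_n => M 0 i)) dFx
    (differentiable_coord _ _ _).
apply: (@Ck_ext _ _ _ _ (fun x => 'D_v F x 0 i)) => //; last exact: IH.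
by move=> x /dF dFx; rewrite derive_mx ?mxE//; exact: diff_derivable.
Qed.

Lemma Ck_comp (V : normedModType R) n k (U : set V) (O : set 'rV[R]_n)
    (F : V -> 'rV[R]_n) (f : 'rV[R]_n -> R) : open U ->
  (forall x, U x -> O (F x)) -> Ck_on k U F -> Ck_on k O f ->
  Ck_on k U (f \o F).
Proof.
move=> oU UO; elim: k f => [|k IH] f.
  by move=> cF cf x Ux; apply: continuous_comp; [exact: cF|exact/cf/UO].
move=> CF [df Df]; have [dF DF] := CF; split=> [x Ux|v].
  by apply: differentiable_comp; [exact: dF|exact/df/UO].
pose e i : 'rV[R]_n := delta_mx 0 i.
apply: (@Ck_ext _ _ _ _
  (\sum_i ((fun x => 'D_v F x 0 i) * ('D_(e i) f \o F)))) => //; last first.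
  apply: Ck_sum => // i; apply: CkM => //; first exact: Ck_coord (DF v).
  by apply: IH; [exact: CkS CF|exact: Df].
move=> x Ux; have dFx := dF _ Ux; have dfx := df _ (UO _ Ux).
rewrite deriveE; last by apply: differentiable_comp.
rewrite diff_comp//= -(deriveE v dFx) (row_sum_delta ('D_v F x)).
rewrite linear_sum fct_sumE; apply: eq_bigr => i _.
by rewrite linearZ /= -deriveE.
Qed.

End SmoothCalculus.

(* A chart is a homeomorphism, with explicit inverse, from an open set of T to
   an open set of R^n; both maps are total functions and their values outside
   of chart_dom, respectively of its image, are irrelevant. *)
Record chart (R : realType) (n : nat) (T : topologicalType) := Chart {
  chart_dom : set T;
  chart_map :> T -> 'rV[R]_n;
  chart_inv : 'rV[R]_n -> T;
  chart_dom_open : open chart_dom;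
  chart_cod_open : open (chart_map @` chart_dom);
  chart_mapK : forall p, chart_dom p -> chart_inv (chart_map p) = p;
  chart_map_continuous : forall p, chart_dom p -> {for p, continuous chart_map};
  chart_inv_continuous : forall x, (chart_map @` chart_dom) x ->
    {for x, continuous chart_inv} }.

Arguments chart_dom_open {R n T} c : rename.
Arguments chart_cod_open {R n T} c : rename.

(* The atlas need not be maximal: it generates the smooth structure. *)
Record manifold (R : realType) (n : nat) := Manifold {
  manifold_sort :> topologicalType;
  atlas : set (chart R n manifold_sort);
  manifold_hausdorff : hausdorff_space manifold_sort;
  manifold_second_countable : @second_countable manifold_sort;
  atlas_cover : forall p : manifold_sort, exists2 c, atlas c & chart_dom c p;
  atlas_compatible : forall c c', atlas c -> atlas c' ->
    smooth_on (c @` (chart_dom c `&` chart_dom c')) (c' \o chart_inv c) }.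

Arguments atlas {R n} M : rename.

Section SmoothFunctions.
Variables (R : realType) (n : nat) (M : manifold R n).

Definition is_smooth : {pred M -> R} := [pred f : M -> R |
  `[< forall c, atlas M c ->
        smooth_on (c @` chart_dom c) (f \o chart_inv c) >]].

Fact is_smooth_subring : subring_closed is_smooth.
Proof.
split.
- by apply/asboolP => c _ k; exact: (@Ck_cst _ _ _ k _ (1 : R)).
- move=> f g /asboolP sf /asboolP sg; apply/asboolP => c cM k.
  have oc := chart_cod_open c.
  rewrite (_ : _ \o _ = (f \o chart_inv c) + cst (-1) * (g \o chart_inv c)).
    apply: CkD => //; first exact: sf.
    by apply: CkM => //; [exact: Ck_cst|exact: sg].
  by apply/funext => x; rewrite !fctE /= mulN1r.
- move=> f g /asboolP sf /asboolP sg; apply/asboolP => c cM k.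
  by apply: CkM; [exact: chart_cod_open|exact: sf|exact: sg].
Qed.

Fact is_smooth_submod : subsemimod_closed is_smooth.
Proof.
have [s1 sB sM] := is_smooth_subring; split; first split.
- by rewrite -(subrr 1); exact: sB.
- move=> f g sf sg; rewrite -[g]opprK; apply: (sB) => //.
  by rewrite -[- g]add0r -(subrr 1) ; apply: (sB) => //; exact: sB.
move=> a f sf; rewrite (_ : a *: f = cst a * f) //; apply: sM => //.
by apply/asboolP => c _ k; exact: (@Ck_cst _ _ _ k _ a).
Qed.

(* The ring C^oo(M), which is also an R-module. *)
Record smooth_fun := SmoothFun {
  smooth_val :> M -> R;
  smoothP : smooth_val \in is_smooth }.

HB.instance Definition _ := [isSub for smooth_val].
HB.instance Definition _ := [Choice of smooth_fun by <:].
HB.instance Definition _ := GRing.SubChoice_isSubComPzRing.Build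
  (M -> R) is_smooth smooth_fun is_smooth_subring.
HB.instance Definition _ := GRing.SubZmodule_isSubLmodule.Build
  R (M -> R) is_smooth smooth_fun is_smooth_submod.

End SmoothFunctions.

Record smooth_map (R : realType) (m n : nat) (N : manifold R m)
    (M : manifold R n) := SmoothMap {
  smooth_map_val :> N -> M;
  smooth_map_continuous : continuous smooth_map_val;
  smooth_map_smooth : forall c c', atlas N c -> atlas M c' ->
    smooth_on (c @` (chart_dom c `&` smooth_map_val @^-1` chart_dom c'))
      (c' \o smooth_map_val \o chart_inv c) }.

Fact id_map_continuous (R : realType) (n : nat) (M : manifold R n) :
  continuous (id : M -> M).
Proof. by move=> p; exact: cvg_id. Qed.

Fact id_map_smooth (R : realType) (n : nat) (M : manifold R n)
    (c c' : chart R n M) : atlas M c -> atlas M c' ->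
  smooth_on (c @` (chart_dom c `&` id @^-1` chart_dom c'))
    (c' \o id \o chart_inv c).
Proof. exact: atlas_compatible. Qed.

Definition id_map (R : realType) (n : nat) (M : manifold R n) :
    smooth_map M M :=
  SmoothMap (@id_map_continuous R n M) (@id_map_smooth R n M).

Fact pullback_smooth (R : realType) (m n : nat) (N : manifold R m)
    (M : manifold R n) (F : smooth_map N M) (f : smooth_fun M) :
  (f : M -> R) \o F \in @is_smooth R m N.
Proof.
apply/asboolP => c cN k; apply: Ck_local => _ [p cp <-].
have [c' c'M c'p] := atlas_cover (F p).
pose A := chart_dom c `&` F @^-1` chart_dom c'.
exists (c @` A); first by exists p.
have oA : open A.
  apply: openI; first exact: chart_dom_open.
  apply: open_comp; last exact: chart_dom_open.
  by move=> q _; exact: smooth_map_continuous.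
have ocA : open (c @` A).
  rewrite (_ : c @` A = (c @` chart_dom c) `&` chart_inv c @^-1` A).
    rewrite openE => x [Cx Ax]; apply: filterI.
      by apply: open_nbhs_nbhs; split => //; exact: chart_cod_open.
    apply: chart_inv_continuous => //.
    by apply: open_nbhs_nbhs; split.
  apply/seteqP; split => [_ [q Aq <-]|_ [[q cq <-]]] /=.
    by have cq := Aq.1; split; [exists q|rewrite chart_mapK].
  by rewrite chart_mapK // => Aq; exists q.
have /asboolP/(_ c' c'M k) Cf := smoothP f.
have CF := smooth_map_smooth F cN c'M k.
have cF x : (c @` A) x -> chart_dom c' (F (chart_inv c x)).
  by move=> [q [cq c'q] <-]; rewrite chart_mapK.
apply: (@Ck_ext _ _ _ _ _
  ((f \o chart_inv c') \o (c' \o F \o chart_inv c))) => //.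
  by move=> x /cF c'x /=; rewrite chart_mapK.
apply: (Ck_comp ocA _ CF Cf) => x /cF c'x.
by exists (F (chart_inv c x)).
Qed.

Definition pullback (R : realType) (m n : nat) (N : manifold R m)
    (M : manifold R n) (F : smooth_map N M) (f : smooth_fun M) : smooth_fun N :=
  SmoothFun (pullback_smooth F f).

Section Tangent.
Variables (R : realType) (n : nat) (M : manifold R n) (p : M).

Definition derivation_at : {pred smooth_fun M -> R} :=
  [pred v : smooth_fun M -> R |
    `[< (forall (a : R) f g, v (a *: f + g) = a * v f + v g) /\
        (forall f g, v (f * g) = f p * v g + g p * v f) >]].

Fact derivation_at_submod : subsemimod_closed derivation_at.
Proof.
split; first split.
- have E f : (0 : smooth_fun M -> R) f = 0 by [].
  by apply/asboolP; split=> *; rewrite !E; ring.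
- move=> v w /asboolP[vL vM] /asboolP[wL wM]; apply/asboolP.
  have E f : (v + w) f = v f + w f by [].
  by split=> *; rewrite !E ?vL ?wL ?vM ?wM; ring.
- move=> b v /asboolP[vL vM]; apply/asboolP.
  have E f : (b *: v) f = b * v f by [].
  by split=> *; rewrite !E ?vL ?vM; ring.
Qed.

(* Tangent vectors at p are the derivations at p of C^oo(M). *)
Record tangent := Tangent {
  tangent_val :> smooth_fun M -> R;
  tangentP : tangent_val \in derivation_at }.

HB.instance Definition _ := [isSub for tangent_val].
HB.instance Definition _ := [Choice of tangent by <:].
HB.instance Definition _ := GRing.SubChoice_isSubLmodule.Build
  R (smooth_fun M -> R) derivation_at tangent derivation_at_submod.

End Tangent.

Section Differential.
Variables (R : realType) (m n : nat) (N : manifold R m) (M : manifold R n).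
Variables (F : smooth_map N M) (p : N).

Fact differential_subproof (v : tangent p) :
  (fun f => v (pullback F f)) \in derivation_at (F p).
Proof.
have /asboolP[vL vM] := tangentP v; apply/asboolP.
split=> [a|] f g.
  by rewrite -vL; congr (v _); exact: val_inj.
by rewrite -(vM (pullback F f) (pullback F g)); congr (v _); exact: val_inj.
Qed.

(* dF_p : T_p N -> T_(F p) M *)
Definition differential (v : tangent p) : tangent (F p) :=
  Tangent (differential_subproof v).

End Differential.

Section FieldAlong.
Variables (R : realType) (m n : nat) (N : manifold R m) (M : manifold R n).
Variable F : smooth_map N M.
Implicit Types (f g : smooth_fun M) (V W : smooth_fun M -> smooth_fun N).

Definition derivation_along : {pred smooth_fun M -> (smooth_fun N)^o} :=
  [pred V : smooth_fun M -> smooth_fun N |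
    `[< (forall (a : R) f g, V (a *: f + g) = a *: V f + V g) /\
        (forall f g,
           V (f * g) = pullback F f * V g + pullback F g * V f) >]].

Fact derivation_along_submod : subsemimod_closed derivation_along.
Proof.
split; first split.
- apply/asboolP; split=> [a|] f g; apply/val_inj/funext => q.
    by change (0 = a * 0 + 0 :> R); ring.
  by change (0 = f (F q) * 0 + g (F q) * 0 :> R); ring.
- move=> V W /asboolP[VL VM] /asboolP[WL WM]; apply/asboolP.
  split=> [a|] f g; apply/val_inj/funext => q.
    change (V (a *: f + g) q + W (a *: f + g) q =
      a * (V f q + W f q) + (V g q + W g q)).
    rewrite VL WL; change (a * V f q + V g q + (a * W f q + W g q) =
      a * (V f q + W f q) + (V g q + W g q)); ring.
  change (V (f * g) q + W (f * g) q =
    f (F q) * (V g q + W g q) + g (F q) * (V f q + W f q)).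
  rewrite VM WM; change (f (F q) * V g q + g (F q) * V f q +
    (f (F q) * W g q + g (F q) * W f q) =
    f (F q) * (V g q + W g q) + g (F q) * (V f q + W f q)); ring.
- move=> b V /asboolP[VL VM]; apply/asboolP.
  split=> [a|] f g; apply/val_inj/funext => q.
    change (b q * V (a *: f + g) q = a * (b q * V f q) + b q * V g q).
    rewrite VL; change (b q * (a * V f q + V g q) =
      a * (b q * V f q) + b q * V g q); ring.
  change (b q * V (f * g) q =
    f (F q) * (b q * V g q) + g (F q) * (b q * V f q)).
  rewrite VM; change (b q * (f (F q) * V g q + g (F q) * V f q) =
    f (F q) * (b q * V g q) + g (F q) * (b q * V f q)); ring.
Qed.

(* The smooth vector fields along F, that is, the smooth sections of F^* TM,
   are the derivations C^oo(M) -> C^oo(N) over the pullback by F; they form a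
   C^oo(N)-module. *)
Record field_along := FieldAlong {
  field_val : smooth_fun M -> (smooth_fun N)^o;
  field_alongP : field_val \in derivation_along }.

HB.instance Definition _ := [isSub for field_val].
HB.instance Definition _ := [Choice of field_along by <:].
HB.instance Definition _ := GRing.SubChoice_isSubLmodule.Build
  (smooth_fun N) (smooth_fun M -> (smooth_fun N)^o)
  derivation_along field_along derivation_along_submod.

Definition lie_derive (V : field_along) (f : smooth_fun M) : smooth_fun N :=
  field_val V f.
Coercion lie_derive : field_along >-> Funclass.

Fact value_at_subproof (V : field_along) (p : N) :
  (fun f => V f p) \in derivation_at (F p).
Proof.
have /asboolP[VL VM] := field_alongP V; apply/asboolP.
by split=> *; rewrite /lie_derive ?VL ?VM.
Qed.

Definition value_at (V : field_along) (p : N) : tangent (F p) :=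
  Tangent (value_at_subproof V p).

End FieldAlong.

Notation vector_field M := (field_along (id_map M)).

Section Tensors.
Variables (R : realType) (n : nat) (M : manifold R n).
Implicit Types (p : M) (f : smooth_fun M) (X Y Z : vector_field M).

Record connection := Connection {
  nabla :> vector_field M -> vector_field M -> vector_field M;
  nablaDl : forall X Y Z, nabla (X + Y) Z = nabla X Z + nabla Y Z;
  nablaZl : forall f X Y, nabla (f *: X) Y = f *: nabla X Y;
  nablaDr : forall X Y Z, nabla X (Y + Z) = nabla X Y + nabla X Z;
  nablaZr : forall X f Y, nabla X (f *: Y) = X f *: Y + f *: nabla X Y }.

Record riemannian_metric := RiemannianMetric {
  metric_val :> forall p, tangent p -> tangent p -> R;
  metricC : forall p (u v : tangent p), metric_val u v = metric_val v u;
  metricP : forall p (a : R) (u v w : tangent p),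
    metric_val (a *: u + v) w = a * metric_val u w + metric_val v w;
  metric_gt0 : forall p (u : tangent p), u != 0 -> 0 < metric_val u u;
  metric_smooth : forall X Y,
    (fun p => metric_val (value_at X p) (value_at Y p)) \in @is_smooth R n M }.

Definition metric_fun (g : riemannian_metric) X Y : smooth_fun M :=
  SmoothFun (metric_smooth g X Y).

Record one_form := OneForm {
  one_form_val :> forall p, tangent p -> R;
  one_formP : forall p (a : R) (u v : tangent p),
    one_form_val (a *: u + v) = a * one_form_val u + one_form_val v;
  one_form_smooth : forall X,
    (fun p => one_form_val (value_at X p)) \in @is_smooth R n M }.

Record tensor11 := Tensor11 {
  tensor11_val :> forall p, tangent p -> tangent p;
  tensor11P : forall p (a : R) (u v : tangent p),
    tensor11_val (a *: u + v) = a *: tensor11_val u + tensor11_val v;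
  tensor11_smooth : forall X f,
    (fun p => tensor11_val (value_at X p) f) \in @is_smooth R n M }.

Fact tensor11_field_subproof (phi : tensor11) X :
  (fun f => SmoothFun (tensor11_smooth phi X f) : (smooth_fun M)^o)
    \in derivation_along (id_map M).
Proof.
apply/asboolP; split=> [a|] f f'; apply/val_inj/funext => p.
  by have /asboolP[vL _] := tangentP (phi p (value_at X p)); exact: vL.
by have /asboolP[_ vM] := tangentP (phi p (value_at X p)); exact: vM.
Qed.

(* The vector field p |-> phi_p X_p *)
Definition tensor11_field (phi : tensor11) X : vector_field M :=
  FieldAlong (tensor11_field_subproof phi X).

(* nabla_X Y - nabla_Y X = [X, Y], evaluated on functions *)
Definition torsion_free (nab : connection) := forall X Y f,
  (nab X Y - nab Y X) f = X (Y f) - Y (X f).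

(* (nabla_X g)(Y, Z) *)
Definition nabla_metric (nab : connection) (g : riemannian_metric) X Y Z :
    smooth_fun M :=
  X (metric_fun g Y Z) - metric_fun g (nab X Y) Z - metric_fun g Y (nab X Z).

(* (nabla_X phi) Y *)
Definition nabla_tensor11 (nab : connection) (phi : tensor11) X Y :
    vector_field M :=
  nab X (tensor11_field phi Y) - tensor11_field phi (nab X Y).

Definition levi_civita (g : riemannian_metric) (nab : connection) :=
  torsion_free nab /\ forall X Y Z, nabla_metric nab g X Y Z = 0.

Definition statistical (g : riemannian_metric) (nab : connection) :=
  torsion_free nab /\
  forall X Y Z, nabla_metric nab g X Y Z = nabla_metric nab g Y X Z.

Definition dual_connections (g : riemannian_metric) (nab nabs : connection) :=
  forall X Y Z,
    X (metric_fun g Y Z) = metric_fun g (nab X Y) Z + metric_fun g Y (nabs X Z).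

Record almost_contact_metric (g : riemannian_metric) (phi : tensor11)
    (xi : vector_field M) (eta : one_form) : Prop := {
  acm_odd : odd n;
  acm_unit : forall p, g p (value_at xi p) (value_at xi p) = 1;
  acm_phi2 : forall p (u : tangent p),
    phi p (phi p u) = - u + eta p u *: value_at xi p;
  acm_eta : forall p (u : tangent p), g p u (value_at xi p) = eta p u;
  acm_phi : forall p (u v : tangent p),
    g p (phi p u) (phi p v) = g p u v - eta p u * eta p v }.

(* nabLC stands for the Levi-Civita connection of g, so that
   K(X, Y) = nab X Y - nabLC X Y. *)
Record sasakian_statistical (g : riemannian_metric) (nab nabLC : connection)
    (phi : tensor11) (xi : vector_field M) (eta : one_form) : Prop := {
  sas_statistical : statistical g nab;
  sas_levi_civita : levi_civita g nabLC;
  sas_contact : almost_contact_metric g phi xi eta;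
  sas_xi : forall X, nabLC X xi = tensor11_field phi X;
  sas_phi : forall X Y, nabla_tensor11 nabLC phi X Y =
    metric_fun g Y xi *: X - metric_fun g Y X *: xi;
  sas_K : forall X Y, let K U V := nab U V - nabLC U V in
    K X (tensor11_field phi Y) + tensor11_field phi (K X Y) = 0 }.

(* A distribution is given by its fibres; smooth_distribution requires it to
   be a subbundle of constant rank, with smooth local frames (global fields
   suffice, since local ones extend after shrinking their domain). *)
Definition tangent_distribution := forall p, set (tangent p).

Definition smooth_distribution (D : tangent_distribution) :=
  exists k : nat, forall p,
  exists E : 'I_k -> vector_field M, \forall q \near p,
    (forall v, D q v <->
       exists a : 'I_k -> R, v = \sum_i a i *: value_at (E i) q) /\
    (forall a : 'I_k -> R,
       \sum_i a i *: value_at (E i) q = 0 -> forall i, a i = 0).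

Definition section_of (D : tangent_distribution) X :=
  forall p, D p (value_at X p).

End Tensors.

Section Submanifolds.
Variables (R : realType) (m n : nat) (M : manifold R m) (Mbar : manifold R n).
Variables (iota : smooth_map M Mbar) (g : riemannian_metric Mbar).
Implicit Types (p : M) (X Y : vector_field M).
Implicit Types V W : field_along iota.

Definition immersed_submanifold :=
  injective iota /\ forall p, injective (@differential R m n M Mbar iota p).

Fact pushforward_subproof X :
  (fun f => X (pullback iota f) : (smooth_fun M)^o) \in derivation_along iota.
Proof.
have /asboolP[XL XM] := field_alongP X; apply/asboolP.
split=> [a|] f f'.
  rewrite -[RHS]XL; congr (field_val X _); exact: val_inj.
rewrite (_ : pullback iota (f * f') = pullback iota f * pullback iota f').
  by rewrite [LHS]XM; apply: val_inj.
exact: val_inj.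
Qed.

(* X, seen as a field along iota: p |-> d iota_p X_p *)
Definition pushforward X : field_along iota :=
  FieldAlong (pushforward_subproof X).

Fact restriction_subproof (Z : vector_field Mbar) :
  (fun f => pullback iota (Z f) : (smooth_fun M)^o) \in derivation_along iota.
Proof.
have /asboolP[ZL ZM] := field_alongP Z; apply/asboolP.
split=> [a|] f f'; apply/val_inj/funext => p.
  by rewrite /= /lie_derive ZL.
by rewrite /= /lie_derive ZM.
Qed.

(* Z restricted to M: p |-> Z_(iota p) *)
Definition restriction (Z : vector_field Mbar) : field_along iota :=
  FieldAlong (restriction_subproof Z).

(* The connection induced by nab on iota^* TMbar, which exists and is uniquely
   determined by these properties; pbnab X (pushforward Y) is what is written
   nab_X Y for vector fields X, Y tangent to M. *)
Record pullback_connection (nab : connection Mbar)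
    (pbnab : vector_field M -> field_along iota -> field_along iota) : Prop := {
  pbnablaDl : forall X Y V, pbnab (X + Y) V = pbnab X V + pbnab Y V;
  pbnablaZl : forall (f : smooth_fun M) X V, pbnab (f *: X) V = f *: pbnab X V;
  pbnablaDr : forall X V W, pbnab X (V + W) = pbnab X V + pbnab X W;
  pbnablaZr : forall X (f : smooth_fun M) V,
    pbnab X (f *: V) = X f *: V + f *: pbnab X V;
  pbnabla_restriction : forall X (Z W : vector_field Mbar) p,
    differential iota (value_at X p) = value_at Z (iota p) ->
    value_at (pbnab X (restriction W)) p = value_at (nab Z W) (iota p) }.

Definition induced_metric p (u v : tangent p) : R :=
  g (iota p) (differential iota u) (differential iota v).

Definition normal_vector p (w : tangent (iota p)) :=
  forall u : tangent p, g (iota p) w (differential iota u) = 0.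

(* nabM and h are the tangential and normal parts of pbnab on TM. *)
Definition gauss_formula
    (pbnab : vector_field M -> field_along iota -> field_along iota)
    (nabM : vector_field M -> vector_field M -> vector_field M)
    (h : vector_field M -> vector_field M -> field_along iota) :=
  forall X Y, pbnab X (pushforward Y) = pushforward (nabM X Y) + h X Y /\
    forall p, normal_vector (value_at (h X Y) p).

Definition orthogonal_complement (D : tangent_distribution M) :
    tangent_distribution M :=
  fun p => [set u | forall v, D p v -> induced_metric u v = 0].

Record contact_CR (phi : tensor11 Mbar) (xi : vector_field Mbar)
    (D : tangent_distribution M) : Prop := {
  cr_smooth : smooth_distribution D;
  cr_direct_sum : forall p (u : tangent p), exists v w,
    [/\ D p v, orthogonal_complement D w & u = v + w];
  cr_xi : exists2 xiM : vector_field M,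
    section_of D xiM & pushforward xiM = restriction xi;
  cr_invariant : forall p (u : tangent p), D p u ->
    exists2 v, D p v & phi (iota p) (differential iota u) = differential iota v;
  cr_antiinvariant : forall p (u : tangent p), orthogonal_complement D u ->
    normal_vector (phi (iota p) (differential iota u)) }.

Definition D_umbilic (D : tangent_distribution M)
    (h : vector_field M -> vector_field M -> field_along iota) :=
  exists2 L : field_along iota, forall p, normal_vector (value_at L p) &
    forall X Y, section_of D X -> section_of D Y ->
      forall p, value_at (h X Y) p =
        induced_metric (value_at X p) (value_at Y p) *: value_at L p.

Definition D_totally_geodesic (D : tangent_distribution M)
    (h : vector_field M -> vector_field M -> field_along iota) :=
  forall X Y, section_of D X -> section_of D Y -> h X Y = 0.

End Submanifolds.

(* Main.v *)
Require Import Defs.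
From mathcomp Require Import all_boot reals.
From mathcomp Require Import all_order all_algebra boolp topology.

(** Evaluate the second fundamental form on the pair [(xi, xi)].  The Reeb field
[xi] is a unit section of [D], so [D]-umbilicity makes the normal field [L] equal
to [h(xi, xi)], the normal part of [nab_xi xi].  Whenever [nab_xi xi] is
proportional to [xi], it is tangent to the submanifold; hence [L = 0] and [h]
vanishes on [D].  This is [D_umbilic_totally_geodesic], which is valid for any
connection.

It remains to see that [nab_xi xi] and [nab*_xi xi] are proportional to [xi],
that is, killed by [phi].  For the difference tensor [K = nab - nabLC], the
identity [K(X, phi Y) + phi K(X, Y) = 0] at [Y = xi] gives [phi K(X, xi) = 0];
since [nabLC_xi xi = phi xi = 0], this settles [nab] ([nabla_Reeb]).  As both
connections are torsion-free, [K] is symmetric, so that also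
[K(xi, phi Y) = - phi K(Y, xi) = 0]: the connections [nab] and [nabLC] agree on
[(xi, phi Y)].  Comparing duality with the compatibility of [nabLC] with [g] then
shows that [nab*_xi xi] is orthogonal to the image of [phi]
([dual_nabla_Reeb]). *)

Set Implicit Arguments.
Unset Strict Implicit.
Unset Printing Implicit Defensive.

Import Order.TTheory GRing.Theory Num.Theory.
Local Open Scope ring_scope.

Section Pointwise.
Variables (R : realType) (n : nat) (M : manifold R n).

Lemma field_ext (m : nat) (N : manifold R m) (F : smooth_map N M)
    (V W : field_along F) :
  (forall p, value_at V p = value_at W p) -> V = W.
Proof.
move=> VW; apply/val_inj/funext => f; apply/val_inj/funext => p.
exact: (congr1 (fun v : tangent (F p) => v f) (VW p)).
Qed.

Variable g : riemannian_metric M.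

Lemma metricDl (p : M) (u v w : tangent p) : g p (u + v) w = g p u w + g p v w.
Proof. by rewrite -[u in LHS]scale1r metricP mul1r. Qed.

Lemma metric0l (p : M) (w : tangent p) : g p 0 w = 0.
Proof. by apply: (addrI (g p 0 w)); rewrite -metricDl !addr0. Qed.

Lemma metric0r (p : M) (w : tangent p) : g p w 0 = 0.
Proof. by rewrite metricC metric0l. Qed.

Lemma metricZl (p : M) a (u w : tangent p) : g p (a *: u) w = a * g p u w.
Proof. by rewrite -[a *: u]addr0 metricP metric0l addr0. Qed.

Lemma metricNl (p : M) (u w : tangent p) : g p (- u) w = - g p u w.
Proof. by rewrite -scaleN1r metricZl mulN1r. Qed.

Lemma metric_eq0 (p : M) (u : tangent p) : g p u u = 0 -> u = 0.
Proof.
move=> guu; apply/eqP/negPn/negP => /(metric_gt0 g).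
by rewrite guu ltxx.
Qed.

Lemma tensor11_0 (phi : tensor11 M) (p : M) : phi p 0 = 0.
Proof.
have := tensor11P phi 1 (0 : tangent p) 0.
by rewrite !scale1r addr0 => E; apply: (addrI (phi p 0)); rewrite -E addr0.
Qed.

Lemma value_at_tensor11 (phi : tensor11 M) (X : vector_field M) (p : M) :
  value_at (tensor11_field phi X) p = phi p (value_at X p).
Proof. exact: val_inj. Qed.

Lemma value_at0 (p : M) : value_at (0 : vector_field M) p = 0.
Proof. exact: val_inj. Qed.

Lemma nabla0r (nab : connection M) X : nab X 0 = 0.
Proof. by apply: (addrI (nab X 0)); rewrite -nablaDr !addr0. Qed.

End Pointwise.

Section Reeb.
Variables (R : realType) (n : nat) (M : manifold R n) (g : riemannian_metric M).
Variables (phi : tensor11 M) (xi : vector_field M) (eta : one_form M).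
Hypothesis acm : almost_contact_metric g phi xi eta.

Lemma phi_norm_eq0 (p : M) (u : tangent p) :
  g p u u = eta p u * eta p u -> phi p u = 0.
Proof.
by move=> guu; apply: (@metric_eq0 _ _ _ g); rewrite (acm_phi acm) guu subrr.
Qed.

Lemma phi_Reeb (p : M) : phi p (value_at xi p) = 0.
Proof.
by apply: phi_norm_eq0; rewrite -(acm_eta acm) (acm_unit acm) mulr1.
Qed.

Lemma phi_eq0 (p : M) (u : tangent p) :
  phi p u = 0 -> u = eta p u *: value_at xi p.
Proof.
move=> phiu; apply/esym/eqP; rewrite -subr_eq0 addrC.
by rewrite -(acm_phi2 acm) phiu tensor11_0.
Qed.

(** As [phi (phi u) = - u + eta u *: xi], the hypothesis reads
[g u u = (eta u)^2], the equality case of the Cauchy-Schwarz inequality for [u]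
and [xi].  So orthogonality to one vector of the image of [phi] already forces
[u] into the kernel. *)
Lemma phi_eq0_orthogonal (p : M) (u : tangent p) :
  g p (phi p (phi p u)) u = 0 -> phi p u = 0.
Proof.
rewrite (acm_phi2 acm) metricDl metricNl metricZl (metricC g (value_at xi p)).
rewrite (acm_eta acm) addrC => /eqP; rewrite subr_eq0 => /eqP E.
exact: phi_norm_eq0.
Qed.

End Reeb.

Section SasakianReeb.
Variables (R : realType) (n : nat) (M : manifold R n) (g : riemannian_metric M).
Variables (nab nabs nabLC : connection M).
Variables (phi : tensor11 M) (xi : vector_field M) (eta : one_form M).
Hypothesis sas : sasakian_statistical g nab nabLC phi xi eta.

Let K X Y := nab X Y - nabLC X Y.

Lemma phi_field_Reeb : tensor11_field phi xi = 0.
Proof.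
apply: field_ext => p.
by rewrite value_at_tensor11 (phi_Reeb (sas_contact sas)) value_at0.
Qed.

Lemma levi_civita_Reeb : nabLC xi xi = 0.
Proof. by rewrite (sas_xi sas) phi_field_Reeb. Qed.

Lemma torsion_free_differenceC X Y : K X Y = K Y X.
Proof.
have [tnab _] := sas_statistical sas; have [tLC _] := sas_levi_civita sas.
have E : nab X Y - nab Y X = nabLC X Y - nabLC Y X.
  apply/val_inj/funext => f.
  exact: etrans (tnab X Y f) (esym (tLC X Y f)).
move/eqP: E; rewrite subr_eq => /eqP; rewrite /K => ->.
by rewrite addrC -addrA addKr addrC.
Qed.

Lemma phi_difference_Reeb X : tensor11_field phi (K X xi) = 0.
Proof.
have := sas_K sas X xi; rewrite /= phi_field_Reeb.
by rewrite !nabla0r subrr add0r.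
Qed.

Lemma nabla_phi_Reeb Y :
  nab xi (tensor11_field phi Y) = nabLC xi (tensor11_field phi Y).
Proof.
have := sas_K sas xi Y; rewrite /= -/(K xi Y) torsion_free_differenceC.
by rewrite phi_difference_Reeb addr0 => /eqP; rewrite subr_eq0 => /eqP.
Qed.

Lemma nabla_Reeb (p : M) :
  exists a : R, value_at (nab xi xi) p = a *: value_at xi p.
Proof.
eexists; apply: (phi_eq0 (sas_contact sas)).
rewrite -value_at_tensor11 -(value_at0 p) -(phi_difference_Reeb xi) /K.
by rewrite levi_civita_Reeb subr0.
Qed.

Lemma dual_nabla_Reeb (dual : dual_connections g nab nabs) (p : M) :
  exists a : R, value_at (nabs xi xi) p = a *: value_at xi p.
Proof.
eexists; apply: (phi_eq0 (sas_contact sas)).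
apply: (phi_eq0_orthogonal (sas_contact sas)).
rewrite -!value_at_tensor11; set Z := tensor11_field phi (nabs xi xi).
(* Both duality and metric compatibility of [nabLC] express [xi (g(Y, xi))]; by
   [nabla_phi_Reeb] the first terms agree, and [nabLC_xi xi = 0] leaves
   [g(Y, nabs_xi xi) = 0]. *)
pose Y := tensor11_field phi Z.
have [_ /(_ xi Y xi)] := sas_levi_civita sas.
rewrite /nabla_metric (dual xi Y xi) (nabla_phi_Reeb Z) levi_civita_Reeb.
move/(congr1 (fun f : smooth_fun M => f p)).
change (g p (value_at (nabLC xi Y) p) (value_at xi p) +
        g p (value_at Y p) (value_at (nabs xi xi) p)
        - g p (value_at (nabLC xi Y) p) (value_at xi p)
        - g p (value_at Y p) (value_at (0 : vector_field M) p) = 0 ->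
        g p (value_at Y p) (value_at (nabs xi xi) p) = 0).
by rewrite value_at0 metric0r subr0 addrAC subrr add0r.
Qed.

End SasakianReeb.

Section Umbilic.
Variables (R : realType) (n : nat) (Mbar : manifold R n).
Variables (g : riemannian_metric Mbar) (nab : connection Mbar).
Variables (phi : tensor11 Mbar) (xi : vector_field Mbar).
Variables (m : nat) (M : manifold R m) (iota : smooth_map M Mbar).
Variables (D : tangent_distribution M).
Variables (pbnab : vector_field M -> field_along iota -> field_along iota).
Variables (nabM : vector_field M -> vector_field M -> vector_field M).
Variables (h : vector_field M -> vector_field M -> field_along iota).

(** A vector [nab_xi xi] proportional to [xi] is tangent to the submanifold, so
its normal part [h(xi, xi) = g(xi, xi) L = L] is orthogonal to itself. *)
Lemma D_umbilic_totally_geodesic :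
  (forall p, g p (value_at xi p) (value_at xi p) = 1) ->
  (forall p, exists a : R, value_at (nab xi xi) p = a *: value_at xi p) ->
  contact_CR iota g phi xi D -> pullback_connection nab pbnab ->
  gauss_formula g pbnab nabM h -> D_umbilic g D h -> D_totally_geodesic D h.
Proof.
move=> xi1 nabxi hCR hpb hGauss [L _ hL].
have [xiM DxiM xiMxi] := cr_xi hCR.
have dxi p : differential iota (value_at xiM p) = value_at xi (iota p).
  apply/val_inj/funext => f.
  exact: (congr1 (fun V : field_along iota => V f p) xiMxi).
have L0 p : value_at L p = 0.
  have [Exi nh] := hGauss xiM xiM; have [a na] := nabxi (iota p).
  have <- : value_at (h xiM xiM) p = value_at L p.
    by rewrite (hL _ _ DxiM DxiM) /induced_metric dxi xi1 scale1r.
  have := pbnabla_restriction hpb xi (dxi p).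
  rewrite -xiMxi Exi na -dxi => E.
  set w := value_at (h xiM xiM) p in E *.
  have Ew : differential iota (value_at (nabM xiM xiM) p) + w =
      a *: differential iota (value_at xiM p).
    rewrite -E; exact: val_inj.
  apply: (@metric_eq0 _ _ _ g).
  have /(congr1 (fun v => g (iota p) v w)) := Ew.
  by rewrite metricDl metricZl !(metricC g _ w) !(nh p) mulr0 add0r.
move=> X Y DX DY; apply: field_ext => p.
by rewrite (hL _ _ DX DY) L0 scaler0; apply: val_inj.
Qed.

End Umbilic.

Theorem theorem3p12 (R : realType)
  (n : nat) (Mbar : manifold R n) (g : riemannian_metric Mbar)
  (nab nabs nabLC : connection Mbar)
  (phi : tensor11 Mbar) (xi : vector_field Mbar) (eta : one_form Mbar)
  (hSasaki : sasakian_statistical g nab nabLC phi xi eta)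
  (hDual : dual_connections g nab nabs)
  (m : nat) (M : manifold R m) (iota : smooth_map M Mbar)
  (hM : immersed_submanifold iota)
  (D : tangent_distribution M) (hCR : contact_CR iota g phi xi D)
  (pbnab pbnabs : vector_field M -> field_along iota -> field_along iota)
  (hpb : pullback_connection nab pbnab)
  (hpbs : pullback_connection nabs pbnabs)
  (nabM nabMs : vector_field M -> vector_field M -> vector_field M)
  (h hs : vector_field M -> vector_field M -> field_along iota)
  (hGauss : gauss_formula g pbnab nabM h)
  (hGausss : gauss_formula g pbnabs nabMs hs) :
  (D_umbilic g D h -> D_totally_geodesic D h) /\
  (D_umbilic g D hs -> D_totally_geodesic D hs).
Proof.
have xi1 := acm_unit (sas_contact hSasaki); split.
  by apply: D_umbilic_totally_geodesic xi1 (nabla_Reeb hSasaki) hCR hpb hGauss.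
by apply: D_umbilic_totally_geodesic xi1 (dual_nabla_Reeb hSasaki hDual) hCR
  hpbs hGausss.
Qed.
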